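(* Let $n$ be a positive integer and $\mathbf b=(b_1,\dots,b_n)\in\mathbb Z_{>0}^n$, not with $n=1=b_1$. The polytope $\mathfrak X'_n(\mathbf b)$ is a polymatroid (namely the polymatroid associated with the submodular function $f_{\mathbf b}$). In fact, $\mathfrak X'_n(\mathbf b)$ is a special polymatroid for which the upper bounds $f_{\mathbf b}(I)$ on the sum of entries in any set $I\subseteq[n]$ depend only on the cardinality $|I|$.
   Context: Write $[n]=\{1,\dots,n\}$. A $\mathbf b$-parking function is a list $(\beta_1,\dots,\beta_n)$ of positive integers whose nondecreasing rearrangement satisfies $\beta'_i\le b_1+\cdots+b_i$ for all $i$, and $\mathfrak X_n(\mathbf b)\subset\mathbb R^n$ is the convex hull of all $\mathbf b$-parking functions. Define $f_{\mathbf b}:2^{[n]}\to\mathbb Z_{\ge 0}$ by $f_{\mathbf b}(\emptyset)=0$ and $f_{\mathbf b}(I)=-|I|+\sum_{j=1}^n\min\{|I|,j\}\,b_{n-j+1}$ for $\emptyset\ne I\subseteq[n]$. Define $$\mathfrak X'_n(\mathbf b)=\Big\{y\in\mathbb R^n: y\ge0,\ \sum_{i\in I}y_i\le f_{\mathbf b}(I)\text{ for all }I\subseteq[n]\Big\},$$ which arises from the inequality description of $\mathfrak X_n(\mathbf b)$ via the substitution $y_i=x_i-1$. A set function $f:2^{[n]}\to\mathbb R$ is submodular if $f(X\cup\{z\})-f(X)\ge f(Y\cup\{z\})-f(Y)$ for all $X\subseteq Y\subseteq[n]$ and $z\in[n]\setminus Y$. The polymatroid associated with a submodular $f$ is $P_f=\{x\in\mathbb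 R^n:x\ge0,\ \sum_{i\in S}x_i\le f(S)\text{ for all }S\subseteq[n]\}$. *)

(* Defs.v *)
From mathcomp Require Import all_boot all_order all_algebra.
From mathcomp Require Import boolp classical_sets reals.

Set Implicit Arguments.
Unset Strict Implicit.
Unset Printing Implicit Defensive.

Import Order.TTheory GRing.Theory Num.Theory.
Local Open Scope ring_scope.

(* [n] = {1, ..., n} is encoded as 'I_n = {0, ..., n-1}: b_i is [b i'] with
   i' = i - 1.  In the sum below the index j' : 'I_n stands for j = j' + 1, and
   rev_ord j' = n - 1 - j' is then the 0-based index of b_(n-j+1). *)
Definition f_park (n : nat) (b : 'I_n -> nat) (I : {set 'I_n}) : int :=
  if I == finset.set0 then 0
  else - #|I|%:Z + \sum_(j < n) (minn #|I| j.+1 * b (rev_ord j))%N%:Z.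

(* f_park is written with values in int so that the subtraction is not
   truncated; for positive b its values are nonnegative. *)
Lemma f_park_ge0 (n : nat) (b : 'I_n -> nat) (I : {set 'I_n}) :
  (forall i, (0 < b i)%N) -> 0 <= f_park b I.
Proof.
move=> b_gt0; rewrite /f_park; case: eqVneq => // /set0Pn[i iI].
rewrite addrC subr_ge0 -(big_morph Posz PoszD (erefl _)) lez_nat.
case: n b I i b_gt0 iI => [b I [] // | n b I i b_gt0 iI].
rewrite (bigD1 ord_max) //=.
apply: leq_trans (leq_addr _ _).
have cI : (#|I| <= n.+1)%N by rewrite -[leqRHS]card_ord max_card.
by rewrite (minn_idPl cI) leq_pmulr.
Qed.

Definition submodular (R : realType) (n : nat) (f : {set 'I_n} -> R) : Prop :=
  forall (X Y : {set 'I_n}) (z : 'I_n),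
    X \subset Y -> z \notin Y ->
    f (z |: Y)%SET - f Y <= f (z |: X)%SET - f X.

Definition polymatroid_of (R : realType) (n : nat) (f : {set 'I_n} -> R) :
    set 'rV[R]_n :=
  [set x : 'rV[R]_n | (forall i, 0 <= x 0 i) /\
    (forall S : {set 'I_n}, \sum_(i in S) x 0 i <= f S)]%classic.

Definition is_polymatroid (R : realType) (n : nat) (P : set 'rV[R]_n) : Prop :=
  exists f : {set 'I_n} -> R, submodular f /\ P = polymatroid_of f.

Definition park_polytope' (R : realType) (n : nat) (b : 'I_n -> nat) :
    set 'rV[R]_n :=
  [set y : 'rV[R]_n | (forall i, 0 <= y 0 i) /\
    (forall I : {set 'I_n}, \sum_(i in I) y 0 i <= (f_park b I)%:~R)]%classic.

(* Main.v *)
Require Import Defs.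
From mathcomp Require Import all_boot all_order all_algebra.
From mathcomp Require Import boolp classical_sets reals.
From mathcomp Require Import zify.

(** For each [j] the map [k |-> minn k j] has nonincreasing increments, hence so
    has every combination of these with nonnegative coefficients plus a linear
    term; [f_park b I] is such a combination evaluated at [#|I|], and a set
    function of the form [g #|I|] with such a [g] is submodular. *)

Import Order.TTheory GRing.Theory Num.Theory.
Local Open Scope ring_scope.

Lemma f_parkE (n : nat) (b : 'I_n -> nat) (I : {set 'I_n}) :
  f_park b I =
    - #|I|%:Z + \sum_(j < n) (minn #|I| j.+1 * b (rev_ord j))%N%:Z.
Proof.
rewrite /f_park; case: eqVneq => // ->.
by rewrite cards0 big1 // => j _; rewrite min0n.
Qed.

Lemma f_park_card (n : nat) (b : 'I_n -> nat) (I J : {set 'I_n}) :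
  #|I| = #|J| -> f_park b I = f_park b J.
Proof. by rewrite !f_parkE => ->. Qed.

(** The increment of [minn k j] at [k] is 1 for [k < j] and 0 afterwards. The additive form avoids
    truncated subtraction. *)
Lemma minn_concave (j x y : nat) : (x <= y)%N ->
  (minn y.+1 j + minn x j <= minn x.+1 j + minn y j)%N.
Proof. lia. Qed.

Lemma f_park_submodular (n : nat) (b : 'I_n -> nat) (X Y : {set 'I_n})
    (z : 'I_n) :
  X \subset Y -> z \notin Y ->
  f_park b (z |: Y)%SET - f_park b Y <= f_park b (z |: X)%SET - f_park b X.
Proof.
move=> sXY zNY.
have zNX : z \notin X by apply: contraNN zNY; apply: (fintype.subsetP sXY).
(* With the negative terms moved across, the linear parts of the two sides agree and the sums over
   [j] compare term by term. *)
rewrite lerBlDr addrAC lerBrDr !f_parkE !cardsU1 zNY zNX !add1n.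
rewrite [leLHS]addrACA [leRHS]addrACA -!big_split /=; apply: lerD; first by lia.
apply: ler_sum => j _; rewrite -!PoszD lez_nat -!mulnDl leq_mul2r.
by rewrite minn_concave ?orbT // subset_leq_card.
Qed.

Theorem theorem4p3 (R : realType) (n : nat) (b : 'I_n -> nat)
    (n_gt0 : (0 < n)%N) (b_gt0 : forall i : 'I_n, (0 < b i)%N)
    (nb1 : ~ (n = 1%N /\ forall i : 'I_n, b i = 1%N)) :
  [/\ is_polymatroid (@park_polytope' R n b),
      submodular (fun I : {set 'I_n} => (f_park b I)%:~R : R),
      @park_polytope' R n b =
        polymatroid_of (fun I : {set 'I_n} => (f_park b I)%:~R : R) &
      forall I J : {set 'I_n}, #|I| = #|J| -> f_park b I = f_park b J].
Proof.
have sub : submodular (fun I : {set 'I_n} => (f_park b I)%:~R : R).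
  by move=> X Y z sXY zNY; rewrite -!intrB ler_int; exact: f_park_submodular.
by split=> //; [exists (fun I => (f_park b I)%:~R) | exact: f_park_card].
Qed.
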